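(* Let the data model, network assumptions, and running consensus algorithm below hold. Then for every node $i\in\{1,\dots,N\}$ and each $l\in\{0,1\}$, the sequence of laws of $x_i(k)$ under $H_l$, $k=1,2,\dots$, satisfies the large deviations principle with good rate function $$I_{(l)}(t)=\frac{(t-m_L^{(l)})^2}{2\sigma_L^2},$$ where $m_L^{(l)}=\frac{(-1)^{l+1}}{2}(m_1-m_0)^\top S^{-1}(m_1-m_0)$ and $\sigma_L^2=(m_1-m_0)^\top S^{-1}(m_1-m_0)$ (the same rate function as for the centralized detector $\frac1k\sum_{j\le k}L(j)$).
   Context: Data model: $N$ sensors; at each time $k=1,2,\dots$ the observation vector is $y(k)=(y_1(k),\dots,y_N(k))^\top$ with $y(k)=m_l+\zeta(k)$ under $H_l$, $l=0,1$, where $m_0\ne m_1\in\mathbb{R}^N$ are constant and $\{\zeta(k)\}$ is i.i.d. $\mathcal{N}(0,S)$ with $S$ positive definite. Let $v=S^{-1}(m_1-m_0)$ and $\eta_i(k)=v_i\big(y_i(k)-\frac{[m_1]_i+[m_0]_i}{2}\big)$, $\eta(k)=(\eta_1(k),\dots,\eta_N(k))^\top$ (so $\sum_i\eta_i(k)=(m_1-m_0)^\top S^{-1}(y(k)-\frac{m_1+m_0}{2})$). Network assumptions: $\{W(k)\}_{k\ge1}$ is a deterministic sequence of $N\times N$ matrices such that (1) each $W(k)$ is symmetric and stochastic (nonnegative entries, rows summing to $1$); (2) there is $W_{\min}\in(0,1)$ with $W_{ii}(k)\ge W_{\min}$ for all $i,k$, and $W_{ij}(k)\ge W_{\min}$ whenever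 $i\ne j$ and $W_{ij}(k)>0$; (3) letting $\mathcal{E}(k)=\{\{i,j\}: i<j,\ W_{ij}(k)>0\}$, there is an integer $B\ge1$ such that for every $k$ the undirected graph on $\{1,\dots,N\}$ with edge set $\bigcup_{l=k+1}^{k+B}\mathcal{E}(l)$ is connected. Running consensus algorithm: $x(1)=N\eta(1)$ and $x(k+1)=\frac{k}{k+1}W(k)x(k)+\frac{1}{k+1}N\eta(k+1)$ for $k\ge1$, where $x(k)=(x_1(k),\dots,x_N(k))^\top$. LDP: a sequence of probability measures $\{\theta_k\}$ on $\mathbb{R}$ satisfies the LDP with rate function $\mathcal{J}$ if for every closed $F$, $\limsup_k\frac1k\log\theta_k(F)\le-\inf_F\mathcal{J}$, and for every open $G$, $\liminf_k\frac1k\log\theta_k(G)\ge-\inf_G\mathcal{J}$; it is good if sublevel sets of $\mathcal{J}$ are compact. *)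

(* Defs.v *)
From HB Require Import structures.
From mathcomp Require Import all_boot all_order all_algebra.
From mathcomp Require Import all_classical all_reals all_analysis.
Set Implicit Arguments. Unset Strict Implicit. Unset Printing Implicit Defensive.
Import Order.TTheory GRing.Theory Num.Theory.
Import numFieldNormedType.Exports.
Local Open Scope classical_set_scope.
Local Open Scope ring_scope.

Section Defs.
Context {R : realType} {d : measure_display} {T : measurableType d}.

Definition sigma_vec (N : nat) (zeta : nat -> 'I_N -> T -> R) (k : nat)
  : set (set T) :=
  <<s \bigcup_(i in [set: 'I_N]) preimage_set_system setT (zeta k i) measurable >>.

Definition indep_vectors (P : probability T R) (N : nat)
  (zeta : nat -> 'I_N -> T -> R) : Prop :=
  forall (K : seq nat) (A : nat -> set T), uniq K -> all (fun k => 0 < k)%N K ->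
    (forall k, k \in K -> sigma_vec zeta k (A k)) ->
    P (\bigcap_(k in [set k | k \in K]) A k) = (\prod_(k <- K) P (A k))%E.

(** zeta(k) ~ N(0,S) for every k >= 1 (definition of a centered Gaussian
    vector: every nontrivial linear combination u^T zeta(k) is normal with
    mean 0 and variance u^T S u; normal_prob takes the standard deviation) *)
Definition gaussian_vectors (P : probability T R) (N : nat)
  (zeta : nat -> 'I_N -> T -> R) (S : 'M[R]_N) : Prop :=
  forall k, (0 < k)%N -> forall u : 'cV[R]_N, u != 0 -> forall B : set R,
    measurable B ->
    P ((fun w => \sum_i u i 0 * zeta k i w) @^-1` B) =
    normal_prob 0 (Num.sqrt ((u^T *m S *m u) 0 0)) B.

Definition obs (N : nat) (m0 m1 : 'cV[R]_N) (zeta : nat -> 'I_N -> T -> R)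
  (l : bool) (k : nat) (w : T) : 'cV[R]_N :=
  (if l then m1 else m0) + \col_i zeta k i w.

Definition eta (N : nat) (m0 m1 : 'cV[R]_N) (S : 'M[R]_N)
  (zeta : nat -> 'I_N -> T -> R) (l : bool) (k : nat) (w : T) : 'cV[R]_N :=
  let v := invmx S *m (m1 - m0) in
  \col_i (v i 0 * (obs m0 m1 zeta l k w i 0 - (m1 i 0 + m0 i 0) / 2)).

(** xs n = x(n+1) of the running consensus algorithm *)
Fixpoint xs (N : nat) (m0 m1 : 'cV[R]_N) (S : 'M[R]_N)
  (zeta : nat -> 'I_N -> T -> R) (W : nat -> 'M[R]_N) (l : bool) (n : nat)
  (w : T) : 'cV[R]_N :=
  match n with
  | 0 => N%:R *: eta m0 m1 S zeta l 1 w
  | n'.+1 => (n%:R / n.+1%:R) *: (W n *m xs m0 m1 S zeta W l n' w)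
             + (n.+1%:R^-1 * N%:R) *: eta m0 m1 S zeta l n.+1 w
  end.

(** x(k), k >= 1 (x(0) is a meaningless placeholder) *)
Definition xrc (N : nat) (m0 m1 : 'cV[R]_N) (S : 'M[R]_N)
  (zeta : nat -> 'I_N -> T -> R) (W : nat -> 'M[R]_N) (l : bool) (k : nat)
  (w : T) : 'cV[R]_N := xs m0 m1 S zeta W l k.-1 w.

Definition law_x (P : probability T R) (N : nat) (m0 m1 : 'cV[R]_N)
  (S : 'M[R]_N) (zeta : nat -> 'I_N -> T -> R) (W : nat -> 'M[R]_N)
  (i : 'I_N) (l : bool) (k : nat) : set R -> \bar R :=
  fun F => P [set w | F (xrc m0 m1 S zeta W l k w i 0)].

End Defs.

Section LDP.
Context {R : realType}.
Local Open Scope ereal_scope.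

(** LDP for a sequence theta_k, k = 1,2,..., of measures on R
    (the k = 0 term is irrelevant for limsup/liminf) *)
Definition LDP (theta : nat -> set R -> \bar R) (J : R -> \bar R) : Prop :=
  (forall F : set R, closed F ->
     limn_esup (fun k => (k%:R^-1)%:E * lne (theta k F)) <= - ereal_inf (J @` F))
  /\
  (forall G : set R, open G ->
     - ereal_inf (J @` G) <= limn_einf (fun k => (k%:R^-1)%:E * lne (theta k G))).

Definition good_rate (J : R -> \bar R) : Prop :=
  forall a : R, compact [set t | J t <= a%:E].

End LDP.

Section Network.
Context {R : realType}.

Definition W_sym_stoch (N : nat) (W : nat -> 'M[R]_N) : Prop :=
  forall k, (0 < k)%N ->
    (W k)^T = W k /\ (forall i j, 0 <= W k i j) /\ (forall i, \sum_j W k i j = 1).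

Definition W_min_cond (N : nat) (W : nat -> 'M[R]_N) : Prop :=
  exists Wmin : R, 0 < Wmin < 1 /\
    forall k, (0 < k)%N ->
      (forall i, Wmin <= W k i i) /\
      (forall i j, i != j -> 0 < W k i j -> Wmin <= W k i j).

Definition union_edge (N : nat) (W : nat -> 'M[R]_N) (k B : nat) : rel 'I_N :=
  fun a b => (a != b) &&
    [exists l : 'I_B, (0 < W (k + l + 1)%N a b) || (0 < W (k + l + 1)%N b a)].

Definition B_connected (N : nat) (W : nat -> 'M[R]_N) : Prop :=
  exists B : nat, (1 <= B)%N /\
    forall k, (0 < k)%N -> forall i j : 'I_N, connect (union_edge W k B) i j.

End Network.

(* Main.v *)
(* Unrolling the recursion, x(k) = (N/k) sum_j W(k-1)...W(j) eta(j), so x_i(k) is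
   an affine function of the independent Gaussian vectors zeta(1), ..., zeta(k) and
   is exactly normal. A backward product of many W's has all its entries close to
   1/N: over a long enough window its entries are bounded below, which contracts
   the oscillation of each column by a fixed factor, and double stochasticity
   identifies the limit. Cesaro averaging then gives E x_i(k) -> mL and
   k Var x_i(k) -> sigmaL2; for normal laws these two limits give the large
   deviations principle by elementary bounds on the density. *)

Require Import Defs.
From HB Require Import structures.
From mathcomp Require Import all_boot all_order all_algebra.
From mathcomp Require Import all_classical all_reals all_analysis.
From mathcomp Require Import measurable_realfun ring lra zify.
Import Order.TTheory GRing.Theory Num.Theory.
Import numFieldNormedType.Exports.
Local Open Scope classical_set_scope.
Local Open Scope ring_scope.

(** * Backward products of consensus matrices and their convergence to averaging *)

Section ConsensusProducts.
Context {R : realType} {N : nat}.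
Implicit Types (A : 'M[R]_N) (W : nat -> 'M[R]_N).

Definition doubly_stochastic A :=
  [/\ forall i j, 0 <= A i j, forall i, \sum_j A i j = 1 &
      forall j, \sum_i A i j = 1].

(** The transition matrix from time [j] to time [j + n]: later factors multiply on the left. *)
Fixpoint trans_mx W (j n : nat) : 'M[R]_N :=
  if n is n'.+1 then W (j + n')%N *m trans_mx W j n' else 1%:M.

Lemma trans_mxD W j n p :
  trans_mx W j (n + p) = trans_mx W (j + n) p *m trans_mx W j n.
Proof.
elim: p => [|p IH]; first by rewrite addn0 mul1mx.
by rewrite addnS /= IH mulmxA addnA.
Qed.

Lemma doubly_stochastic1 : doubly_stochastic 1%:M.
Proof.
split=> [i j|i|j]; first by rewrite mxE ler0n.
- rewrite (bigD1 i)//= mxE eqxx big1 ?addr0// => j /negbTE ji.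
  by rewrite mxE eq_sym ji.
- rewrite (bigD1 j)//= mxE eqxx big1 ?addr0// => i /negbTE ij.
  by rewrite mxE ij.
Qed.

Lemma doubly_stochasticM A B :
  doubly_stochastic A -> doubly_stochastic B -> doubly_stochastic (A *m B).
Proof.
move=> [A0 Ar Ac] [B0 Br Bc]; split=> [i j|i|j].
- by rewrite mxE sumr_ge0// => k _; rewrite mulr_ge0.
- under eq_bigr do rewrite mxE; rewrite exchange_big/= -[RHS](Ar i).
  by apply: eq_bigr => k _; rewrite -mulr_sumr Br mulr1.
- under eq_bigr do rewrite mxE; rewrite exchange_big/= -[RHS](Bc j).
  by apply: eq_bigr => k _; rewrite -mulr_suml Ac mul1r.
Qed.

(** Symmetry turns the row sums of each factor into column sums, and products preserve both. *)
Lemma trans_mx_doubly_stochastic W j n : W_sym_stoch W -> (0 < j)%N ->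
  doubly_stochastic (trans_mx W j n).
Proof.
move=> HW j0; elim: n => [|n IH]; first exact: doubly_stochastic1.
apply: doubly_stochasticM => //.
have [Wsym [W0 W1]] := HW (j + n)%N (ltn_addr _ j0).
split => // k; rewrite -[RHS](W1 k); apply: eq_bigr => i _.
by rewrite -[in LHS]Wsym mxE.
Qed.

Lemma connect_exit (T : finType) (e : rel T) (D : pred T) x y :
  connect e x y -> D x -> ~~ D y -> exists a b, [/\ D a, ~~ D b & e a b].
Proof.
move=> /connectP[p]; elim: p x => [|z p IH] x /=.
  by move=> _ -> ->.
move=> /andP[exz pz] yE Dx Dy; have [Dz|Dz] := boolP (D z); first exact: (IH z).
by exists x, z.
Qed.

(* The set of nodes whose weight is at least w^n never shrinks, and gains a node
   in every window of length B until it is full. *)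
Lemma trans_mx_ge W (w : R) (B : nat) : 0 < w ->
  W_sym_stoch W ->
  (forall k, (0 < k)%N -> (forall i, w <= W k i i) /\
    (forall i j, i != j -> 0 < W k i j -> w <= W k i j)) ->
  (forall k, (0 < k)%N -> forall i j, connect (union_edge W k B) i j) ->
  forall j, (0 < j)%N -> forall i r, w ^+ (N * B).+1 <= trans_mx W j (N * B).+1 i r.
Proof.
move=> w0 HW Hw HB j j0 i r.
have jn n : (0 < j + n)%N by rewrite ltn_addr.
pose D n : {set 'I_N} := [set i : 'I_N | w ^+ n <= trans_mx W j n i r]%SET.
have step n a b : w <= W (j + n)%N b a -> a \in D n -> b \in D n.+1.
  rewrite !inE => wab wa /=.
  have [_ [W0 _]] := HW _ (jn n); have [T0 _ _] := trans_mx_doubly_stochastic W j n HW j0.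
  rewrite mxE (bigD1 a)//= exprS -[leLHS]addr0 lerD//.
    by apply: ler_pM => //; [exact: ltW|rewrite exprn_ge0// ltW].
  by rewrite sumr_ge0// => k _; rewrite mulr_ge0.
have mono n p : D n \subset D (n + p)%N.
  elim: p => [|p IH]; first by rewrite addn0.
  apply: (fintype.subset_trans IH); apply/fintype.subsetP => a aD.
  by rewrite addnS; apply: step aD; have [+ _] := Hw _ (jn (n + p)%N); exact.
have grow n : (0 < n)%N -> r \in D n -> D n != [set: 'I_N]%SET ->
    (#|D n| < #|D (n + B)%N|)%N.
  move=> n0 rD; rewrite -properT => /properP[_ [y _ yD]].
  (* The window of [union_edge] at [k] starts with [W (k + 1)]. Taking k = j + n - 1 makes it start
     with [W (j + n)], the next factor to be multiplied; this is where n > 0 matters. *)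
  have k0 : (0 < j + n.-1)%N by exact: jn.
  have [a [b [aD bD /andP[ab /existsP[l eab]]]]] :=
    connect_exit _ _ (fun a => a \in D n) _ _ (HB _ k0 r y) rD yD.
  apply: proper_card; apply/properP; split; first exact: mono.
  exists b => //.
  have kE : (j + n.-1 + l + 1 = j + (n + l))%N by lia.
  rewrite kE in eab.
  have Wba : 0 < W (j + (n + l))%N b a.
    have [Wsym _] := HW _ (jn (n + l)%N).
    by case/orP: eab => //; rewrite -[in X in X -> _]Wsym mxE.
  (* Node [a] keeps its weight up to time [n + l], when the edge from [a] to [b] is active and hands
     a fraction at least [w] of it to [b]. *)
  have bD1 : b \in D (n + l).+1.
    apply: (step (n + l)%N a); last exact: (fintype.subsetP (mono n l)).
    by have [_] := Hw _ (jn (n + l)%N); apply => //; rewrite eq_sym.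
  have -> : (n + B = (n + l).+1 + (B - l.+1))%N by have := ltn_ord l; lia.
  exact: (fintype.subsetP (mono _ _)).
have r0 : r \in D 0%N by rewrite inE expr0 /= mxE eqxx.
have rD n : r \in D n by exact: (fintype.subsetP (mono 0%N n)).
(* Counting starts at time 1 because [grow] needs n > 0, whence the successor in the exponent. After
   [N] windows more than [N] nodes would be needed, so the set is full. *)
have card q : (q < #|D (q * B).+1|)%N \/ D (q * B).+1 = [set: 'I_N]%SET.
  elim: q => [|q [IH|IH]].
  - by left; apply/card_gt0P; exists r.
  - have [DT|DT] := eqVneq (D (q * B).+1) [set: 'I_N]%SET.
      right; apply/eqP; rewrite -finset.subTset -[in X in X \subset _]DT.
      by rewrite mulSn addnC -addSn; exact: mono.
    left; apply: (leq_ltn_trans IH).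
    by rewrite mulSn addnC -addSn; apply: grow.
  - right; apply/eqP; rewrite -finset.subTset -[in X in X \subset _]IH.
    by rewrite mulSn addnC -addSn; exact: mono.
suff : i \in D (N * B).+1 by rewrite inE.
have [|->] := card N; last by rewrite inE.
by move=> /(leq_trans)/(_ (max_card _)); rewrite card_ord ltnn.
Qed.

(** Each row gives weight at least [e] to the entry [l]; in the averages of x - a and of b - x only
    that term is kept. The new interval has length (1 - e)(b - a), whatever the value of [x l]. *)
Lemma stochastic_contract A (e a b : R) (x : 'I_N -> R) (l : 'I_N) :
  0 <= e -> doubly_stochastic A -> (forall i j, e <= A i j) ->
  (forall i, a <= x i <= b) ->
  forall i, a + e * (x l - a) <= \sum_j A i j * x j <= b - e * (b - x l).
Proof.
move=> e0 [A0 A1 _] Ae xab i.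
have xa j : 0 <= x j - a by have /andP[? ?] := xab j; rewrite subr_ge0.
have xb j : 0 <= b - x j by have /andP[? ?] := xab j; rewrite subr_ge0.
have E1 : \sum_j A i j * (x j - a) = (\sum_j A i j * x j) - a.
  under eq_bigr do rewrite mulrBr.
  by rewrite sumrB -mulr_suml A1 mul1r.
have E2 : \sum_j A i j * (b - x j) = b - \sum_j A i j * x j.
  under eq_bigr do rewrite mulrBr.
  by rewrite sumrB -mulr_suml A1 mul1r.
have H1 : e * (x l - a) <= \sum_j A i j * (x j - a).
  rewrite (bigD1 l)//= -[leLHS]addr0 lerD ?ler_wpM2r//.
  by rewrite sumr_ge0// => k _; rewrite mulr_ge0.
have H2 : e * (b - x l) <= \sum_j A i j * (b - x j).
  rewrite (bigD1 l)//= -[leLHS]addr0 lerD ?ler_wpM2r//.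
  by rewrite sumr_ge0// => k _; rewrite mulr_ge0.
by apply/andP; split; lra.
Qed.

(** The contraction is iterated over [q] consecutive blocks of length [L], starting from the
    interval [0, 1] that contains a column of the identity. *)
Lemma trans_mx_osc W (e : R) (L : nat) : 0 <= e -> W_sym_stoch W ->
  (forall j, (0 < j)%N -> forall i r, e <= trans_mx W j L i r) ->
  forall j q r, (0 < j)%N -> exists a b, b - a = (1 - e) ^+ q /\
    forall i, a <= trans_mx W j (q * L) i r <= b.
Proof.
move=> e0 HW HL j q r j0; elim: q => [|q [a [b [ab H]]]].
  exists 0, 1; split => [|i]; first by rewrite subr0 expr0.
  by rewrite mul0n /= mxE; case: (i == r); rewrite /= ?ler01 ?lexx.
have jq : (0 < j + q * L)%N by rewrite ltn_addr.
(* The reference entry [r] is an arbitrary choice: the length of the new interval does not depend on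
   it. *)
have := @stochastic_contract _ e a b (fun k => trans_mx W j (q * L) k r) r e0
  (trans_mx_doubly_stochastic W _ L HW jq) (HL _ jq) H.
set y := trans_mx W j (q * L) r r => H1.
exists (a + e * (y - a)), (b - e * (b - y)); split.
  by rewrite exprS -ab; ring.
by move=> i; rewrite mulSn addnC trans_mxD mxE.
Qed.

(** The filter constrains only the number of factors, so the convergence is uniform in the starting
    time. *)
Lemma trans_mx_cvg W : W_sym_stoch W -> W_min_cond W -> B_connected W ->
  forall i r, (fun p : nat * nat => trans_mx W p.1.+1 p.2 i r) @
    filter_prod (globally setT) \oo --> (N%:R^-1 : R).
Proof.
move=> HW [w [/andP[w0 w1] Hw]] [B [_ HB]] i r.
pose L := (N * B).+1; pose e := w ^+ L.
have HL := trans_mx_ge W w B w0 HW Hw HB.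
have e0 : 0 < e by rewrite exprn_gt0.
have e1 : e <= 1 by rewrite exprn_ile1// ltW.
have N0 : (0 : R) < N%:R by rewrite ltr0n; case: (N) i => [[]|].
apply/cvgrPdist_le => eps eps0.
have : (fun q : nat => (1 - e) ^+ q) @ \oo --> (0 : R).
  by apply: cvg_expr; rewrite ger0_norm; lra.
move=> /cvgrPdist_le /(_ _ eps0) [q _ /(_ q (leqnn _))] /=.
rewrite sub0r normrN => qeps.
exists (setT, [set n | (q * L <= n)%N]) => /=.
  by split=> //; exact: nbhs_infty_ge.
move=> [j n] [_ /= qn].
have [a [b [ab H]]] := trans_mx_osc W e L (ltW e0) HW HL j.+1 q r (ltn0Sn j).
have jq : (0 < j.+1 + q * L)%N by [].
have DS := trans_mx_doubly_stochastic W _ (n - q * L) HW jq.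
(* The factors beyond the first [q * L] only average the entries of the column, so they stay in
   [a, b]; this is the contraction lemma with e = 0. *)
have Hn k : a <= trans_mx W j.+1 n k r <= b.
  rewrite -(subnKC qn) trans_mxD mxE.
  have [DS0 _ _] := DS.
  have := @stochastic_contract _ 0 a b (fun k => trans_mx W j.+1 (q * L) k r) r
    (lexx _) DS DS0 H k.
  by rewrite !mul0r addr0 subr0.
(* The [N] entries of the column lie in [a, b] and sum to 1, so their mean 1/N lies there too. *)
have [_ _ colsum] := trans_mx_doubly_stochastic W j.+1 n HW (ltn0Sn j).
have avg_ge : a <= N%:R^-1.
  rewrite -[leRHS]mul1r ler_pdivlMr// -[leRHS](colsum r).
  rewrite mulr_natr -[X in _ *+ X]card_ord -sumr_const ler_sum// => k _.
  by have /andP[] := Hn k.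
have avg_le : N%:R^-1 <= b.
  rewrite -[leLHS]mul1r ler_pdivrMr// -[leLHS](colsum r).
  rewrite mulr_natr -[X in _ *+ X]card_ord -sumr_const ler_sum// => k _.
  by have /andP[] := Hn k.
have /andP[Hi1 Hi2] := Hn i.
have := ler_norm ((1 - e) ^+ q); rewrite ler_norml.
by move=> ?; apply/andP; split; lra.
Qed.

End ConsensusProducts.

(** * Cesaro averages along antidiagonals *)

Section Cesaro.
Context {R : realType}.

(** On the antidiagonal j + n = k - 1 at most [M] indices have n < M. Their bounded contribution
    vanishes after division by [k], and the other terms are close to [c] uniformly in [j]. *)
Lemma cesaro_diag (g : nat * nat -> R) (c C : R) :
  (forall p, `|g p| <= C) -> g @ filter_prod (globally setT) \oo --> c ->
  (fun k : nat => k%:R^-1 * \sum_(j < k) g (j : nat, (k.-1 - j)%N)) @ \oo --> c.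
Proof.
move=> gC gc; apply/cvgrPdist_le => e e0.
have e20 : 0 < e / 2 by rewrite divr_gt0.
move/cvgrPdist_le : gc => /(_ _ e20) [[P Q] /= [PT [M _ MQ]] PQ].
have gM j n : (M <= n)%N -> `|c - g (j, n)| <= e / 2.
  by move=> Mn; apply: (PQ (j, n)); split; [exact: PT|exact: MQ].
pose D := `|c| + C.
have D0 : 0 <= D by rewrite addr_ge0// (le_trans _ (gC (0%N, 0%N))).
near=> k.
have k0 : (0 : R) < k%:R by rewrite ltr0n; near: k; exact: nbhs_infty_gt.
have -> : c - k%:R^-1 * \sum_(j < k) g (j : nat, (k.-1 - j)%N) =
    k%:R^-1 * \sum_(j < k) (c - g (j : nat, (k.-1 - j)%N)).
  rewrite sumrB sumr_const card_ord mulrBr -[c *+ k]mulr_natl mulrA mulVf ?mul1r//.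
  by rewrite gt_eqF.
rewrite normrM ger0_norm ?invr_ge0 ?(ltW k0)// ler_pdivrMl//.
apply: (le_trans (ler_norm_sum _ _ _)).
(* Each term costs e/2, plus the crude bound [D] when fewer than [M] factors are available. *)
apply: (@le_trans _ _ (\sum_(j < k) (e / 2 + D * (k.-1 - j < M)%N%:R))).
  apply: ler_sum => j _; case: ltnP => jM; last by rewrite mulr0 addr0 gM.
  rewrite mulr1 -[leLHS]add0r lerD ?(ltW e20)//.
  by apply: (le_trans (ler_normB _ _)); rewrite lerD2l.
rewrite big_split/= sumr_const card_ord -mulr_sumr.
have -> : \sum_(j < k) ((k.-1 - j < M)%N%:R : R) = \sum_(j < k) (j < M)%N%:R.
  rewrite (reindex_inj rev_ord_inj)/=; apply: eq_bigr => j _.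
  by congr ((nat_of_bool (_ < M)%N)%:R); have := ltn_ord j; lia.
have card_le n : \sum_(j < n) ((j < M)%N%:R : R) <= M%:R.
  suff -> : \sum_(j < n) ((j < M)%N%:R : R) = (minn n M)%:R.
    by rewrite ler_nat geq_minr.
  elim: n => [|n IH]; first by rewrite big_ord0 min0n.
  by rewrite big_ord_recr/= IH -natrD; congr (_%:R); case: ltnP; lia.
have : D * \sum_(j < k) ((j < M)%N%:R : R) <= D * M%:R by rewrite ler_wpM2l.
(* From this threshold on, the exceptional terms add up to at most k e/2. *)
have : D * M%:R / (e / 2) <= k%:R by near: k; exact: nbhs_infty_ger.
rewrite ler_pdivrMr// -mulr_natl; lra.
Unshelve. all: by end_near. Qed.

End Cesaro.

(** * Translation and convolution of normal laws *)

Section NormalConvolution.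
Context {R : realType}.
Local Notation mu := (@lebesgue_measure R).
Implicit Types (m s t x y : R) (B : set R).

Definition translate x : measurableTypeR R -> measurableTypeR R :=
  fun y => x + y.

Lemma measurable_translate x : measurable_fun setT (translate x).
Proof. exact: measurable_funD. Qed.

HB.instance Definition _ x :=
  isMeasurableFun.Build _ _ _ _ (translate x) (measurable_translate x).

Lemma lebesgue_measure_translate x B : measurable B ->
  pushforward mu (translate x) B = mu B.
Proof.
move=> mB; apply/esym/lebesgue_measure_unique => //= _ [[a b]] _ <-.
rewrite /pushforward.
rewrite (_ : _ @^-1` _ = `]a - x, b - x]%classic); last first.
  rewrite /translate.
  by apply/seteqP; split => y /=; rewrite !in_itv/= => /andP[? ?]; apply/andP; split; lra.
rewrite !lebesgue_measure_itv/= !lte_fin ltrD2r.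
by case: ifP => // _; congr (_%:E); ring.
Qed.

Lemma normal_prob_translate x s B : measurable B -> s != 0 ->
  normal_prob 0 s (translate x @^-1` B) = normal_prob x s B.
Proof.
move=> mB s0; rewrite /normal_prob.
transitivity (\int[pushforward mu (translate x)]_(y in B)
  (normal_pdf x s y)%:E)%E.
  rewrite ge0_integral_pushforward//=; first last.
  - by move=> y _; rewrite lee_fin normal_pdf_ge0.
  - by apply/measurable_EFinP/measurable_funTS; exact: measurable_normal_pdf.
  have xK (y : R) : (translate x y : R) - x = y - 0.
    by rewrite /translate subr0 addrAC subrr add0r.
  by apply: eq_integral => y _ /=; rewrite !normal_pdfE// /normal_fun xK.
by apply: eq_measure_integral => //= A mA _; exact: lebesgue_measure_translate.
Qed.

(** The normal density agrees almost everywhere with the Radon-Nikodym derivative, since both have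
    the same integral over every measurable set. *)
Lemma integral_normal_prob m s (f : R -> \bar R) : measurable_fun setT f ->
  (\int[normal_prob m s]_x `|f x| < +oo)%E ->
  (\int[normal_prob m s]_x f x = \int[mu]_x (f x * (normal_pdf m s x)%:E))%E.
Proof.
move=> mf finf.
rewrite -(Radon_Nikodym_change_of_variables (normal_prob_dominates m s))//=; last first.
  by apply/integrableP; split.
apply: ae_eq_integral => //.
- apply: emeasurable_funM => //; apply: (measurable_int mu).
  by apply: Radon_Nikodym_integrable; exact: normal_prob_dominates.
- apply: emeasurable_funM => //=; apply/measurableT_comp => //=.
  exact: measurable_normal_pdf.
- apply: ae_eqe_mul2l => /=.
  rewrite Radon_NikodymE//=; first exact: normal_prob_dominates.
  move=> smu; case: cid => /= h [h1 h2 h3].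
  apply: integral_ae_eq => //=.
  + by apply/measurableT_comp =>//; exact: measurable_normal_pdf.
  + by move=> E E01 mE; rewrite -h3.
Qed.

(* Completing the square in x. *)
Lemma normal_pdf_mul s t x y : 0 < s -> 0 < t ->
  let r := Num.sqrt (s ^+ 2 + t ^+ 2) in
  normal_pdf x t y * normal_pdf 0 s x =
  normal_pdf 0 r y * normal_pdf (s ^+ 2 * y / r ^+ 2) (s * t / r) x.
Proof.
move=> s0 t0 r.
have q0 : 0 < s ^+ 2 + t ^+ 2 by rewrite addr_gt0// exprn_gt0.
have r0 : 0 < r by rewrite sqrtr_gt0.
have r2 : r ^+ 2 = s ^+ 2 + t ^+ 2 by rewrite sqr_sqrtr// ltW.
have c0 : 0 < s * t / r by rewrite !mulr_gt0// invr_gt0.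
rewrite !normal_pdfE ?gt_eqF// mulrACA [RHS]mulrACA; congr (_ * _).
- rewrite /normal_peak -!invfM -!sqrtrM ?mulrn_wge0// ?(mulr_ge0 (sqr_ge0 _))// ?pi_ge0//.
  congr (Num.sqrt _)^-1; rewrite !exprMn !exprVn; field.
  by rewrite gt_eqF.
- rewrite /normal_fun -!expRD; congr expR.
  rewrite !exprMn !exprVn r2; field.
  by rewrite !gt_eqF.
Qed.

Let measurable_normal_pdf2 t (B : set R) : t != 0 -> measurable B ->
  measurable_fun setT (fun p : measurableTypeR R * measurableTypeR R =>
    (normal_pdf p.1 t p.2 * \1_B p.2)%:E).
Proof.
move=> t0 mB; apply/measurable_EFinP; apply: measurable_funM; last first.
  by apply: measurableT_comp => //; exact: measurable_indic.
under eq_fun do rewrite normal_pdfE//.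
apply: measurable_funM => //; apply: measurableT_comp => //.
apply: measurable_funM => //; apply: measurableT_comp => //.
by apply: measurable_funX; apply: measurable_funB.
Qed.

(** Translating the centered law gives mean [x]; Tonelli then exchanges the integrals, and after
    completing the square the factor in [x] is a normal density of total mass 1. *)
Lemma normal_prob_convolution s t B : 0 < s -> 0 < t -> measurable B ->
  (\int[normal_prob 0 s]_x normal_prob 0 t (translate x @^-1` B) =
   normal_prob 0 (Num.sqrt (s ^+ 2 + t ^+ 2)) B)%E.
Proof.
move=> s0 t0 mB; have tn0 : t != 0 by rewrite gt_eqF.
under eq_integral do rewrite normal_prob_translate//.
have gE x : normal_prob x t B =
    (\int[mu]_y (normal_pdf x t y * \1_B y)%:E)%E.
  rewrite /normal_prob integral_mkcond; apply: eq_integral => y _.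
  rewrite patchE indicE; case: ifP => _; by rewrite ?mulr1 ?mulr0.
have mg : measurable_fun setT (fun x => normal_prob x t B).
  under eq_fun do rewrite gE.
  apply: (measurable_fun_fubini_tonelli_F
    (fun p : measurableTypeR R * measurableTypeR R =>
      (normal_pdf p.1 t p.2 * \1_B p.2)%:E)).
    exact: measurable_normal_pdf2.
  by move=> p; rewrite lee_fin mulr_ge0 ?normal_pdf_ge0.
(* Integrability: the integrand is a probability, hence at most 1. *)
rewrite integral_normal_prob//; last first.
  apply: (@le_lt_trans _ _ (\int[normal_prob 0 s]_x cst 1 x)%E).
    apply: ge0_le_integral => //=.
      exact: measurableT_comp.
    by move=> x _; rewrite gee0_abs// probability_le1.
  by rewrite integral_cst//= mul1e probability_setT ltry.
pose h (p : measurableTypeR R * measurableTypeR R) : \bar R :=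
  ((normal_pdf p.1 t p.2 * \1_B p.2)%:E * (normal_pdf 0 s p.1)%:E)%E.
have h0 p : (0 <= h p)%E.
  by rewrite /h -EFinM lee_fin !mulr_ge0 ?normal_pdf_ge0.
transitivity (\int[mu]_x \int[mu]_y h (x, y))%E.
  apply: eq_integral => x _; rewrite gE /h /= ge0_integralZr//.
  - apply/measurable_EFinP/measurable_funM; first exact: measurable_normal_pdf.
    exact: measurable_indic.
  - by move=> y _; rewrite lee_fin mulr_ge0 ?normal_pdf_ge0.
  - by rewrite lee_fin normal_pdf_ge0.
rewrite fubini_tonelli//; last first.
  apply: emeasurable_funM; first exact: measurable_normal_pdf2.
  apply/measurable_EFinP; apply: measurableT_comp => //.
  exact: measurable_normal_pdf.
rewrite [RHS]integral_mkcond; apply: eq_integral => y _.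
rewrite patchE /h /=.
set r := Num.sqrt _.
transitivity (\int[mu]_x ((\1_B y * normal_pdf 0 r y)%:E *
    (normal_pdf (s ^+ 2 * y / r ^+ 2) (s * t / r) x)%:E))%E.
  apply: eq_integral => x _; rewrite -!EFinM; congr _%:E.
  by rewrite mulrAC normal_pdf_mul// -/r; ring.
rewrite ge0_integralZl//.
- rewrite integral_normal_pdf mule1 indicE.
  by case: ifP => _; rewrite ?mul1r ?mul0r.
- apply/measurable_EFinP; exact: measurable_normal_pdf.
- by move=> x _; rewrite lee_fin normal_pdf_ge0.
- by rewrite lee_fin mulr_ge0 ?normal_pdf_ge0.
Qed.

End NormalConvolution.

(** * Sums of independent normal variables *)

Section IndependentNormalSum.
Context {R : realType} {d : measure_display} {T : measurableType d}.
Context (P : probability T R).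

(** Conditionally on [E], the pair (X, Z) has the product law on rectangles, hence on all measurable
    sets of the plane, and the law of the sum is a convolution. Carrying [E] along keeps
    independence from other variables available. *)
Lemma normal_sum_indep (X Z : T -> R) (E : set T) (s t : R) :
  0 < s -> 0 < t -> measurable E ->
  measurable_fun setT X -> measurable_fun setT Z ->
  (forall A B, measurable A -> measurable B ->
    P (X @^-1` A `&` Z @^-1` B `&` E) =
    (normal_prob 0 s A * normal_prob 0 t B * P E)%E) ->
  forall B, measurable B ->
    P ((fun w => X w + Z w) @^-1` B `&` E) =
    (normal_prob 0 (Num.sqrt (s ^+ 2 + t ^+ 2)) B * P E)%E.
Proof.
move=> s0 t0 mE mX mZ indep B mB.
have mXZ : measurable_fun setT
    (fun w => (X w, Z w) : measurableTypeR R * measurableTypeR R).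
  exact/measurable_fun_pairP.
have mXB (D : set (measurableTypeR R * measurableTypeR R)) : measurable D ->
    measurable ((fun w => (X w, Z w)) @^-1` D).
  by move=> mD; rewrite -[X in measurable X]setTI; exact: mXZ.
have mS : measurable [set p : measurableTypeR R * measurableTypeR R | B (p.1 + p.2)].
  rewrite -[X in measurable X]setTI.
  have : measurable_fun setT
    (fun p : measurableTypeR R * measurableTypeR R => p.1 + p.2).
    exact: measurable_funD.
  by apply.
(* Conditioning on [E] divides by its probability, so the null case is separate: both sides
   vanish. *)
have [PE0|PE0] := eqVneq (P E) 0%E.
  rewrite PE0 mule0; apply/eqP; rewrite -measure_le0 -PE0.
  by apply: le_measure; rewrite ?inE//; apply: measurableI => //; exact: (mXB _ mS).
have PEfin : P E \is a fin_num by exact: fin_num_measure.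
have c_ge0 : 0 <= (fine (P E))^-1 by rewrite invr_ge0 fine_ge0.
pose pf : {measure set (measurableTypeR R * measurableTypeR R) -> \bar R} :=
  measure_function_pushforward__canonical__measure_function_Measure
    (mrestr P mE) mXZ.
(* The joint law of (X, Z) conditioned on [E]. *)
pose m' : {measure set (measurableTypeR R * measurableTypeR R) -> \bar R} :=
  mscale (NngNum c_ge0) pf.
have cPE : ((fine (P E))^-1%:E * P E = 1)%E.
  by rewrite -[X in (_ * X)%E](fineK PEfin) -EFinM mulVf// fine_eq0.
have m'V D : m' D = ((fine (P E))^-1%:E *
    P ((fun w => (X w, Z w)) @^-1` D `&` E))%E by [].
have m'E A C : measurable A -> measurable C ->
    m' (A `*` C) = (normal_prob 0 s A * normal_prob 0 t C)%E.
  by move=> mA mC; rewrite m'V indep// muleCA cPE mule1.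
have := product_measure_unique m'E mS.
rewrite /product_measure1 /=.
under eq_integral => x _.
  rewrite (_ : xsection _ x = translate x @^-1` B); last first.
    by rewrite /xsection/=; apply/seteqP; split => y /=; rewrite inE.
  over.
rewrite normal_prob_convolution// => ->.
rewrite m'V.
by rewrite muleAC cPE mul1e.
Qed.

(** Degenerate terms form a separate alternative because [normal_prob] is defined by a density, so
    deviation 0 does not give the point mass at 0. *)
Lemma normal_sum (Y : nat -> T -> R) (v : nat -> R) :
  (forall k, measurable_fun setT (Y k)) ->
  (forall (K : seq nat) (A : nat -> set R), uniq K ->
    (forall k, measurable (A k)) ->
    P (\bigcap_(k in [set` K]) Y k @^-1` A k) =
    (\prod_(k <- K) P (Y k @^-1` A k))%E) ->
  (forall k, (v k = 0 /\ forall w, Y k w = 0) \/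
    (0 < v k /\ forall B, measurable B ->
      P (Y k @^-1` B) = normal_prob 0 (Num.sqrt (v k)) B)) ->
  forall n, 0 < \sum_(k < n) v k -> forall B, measurable B ->
    P ((fun w => \sum_(k < n) Y k w) @^-1` B) =
    normal_prob 0 (Num.sqrt (\sum_(k < n) v k)) B.
Proof.
move=> mY indepY lawY n.
pose E (K : seq nat) (A : nat -> set R) : set T := \bigcap_(k in [set` K]) Y k @^-1` A k.
have mYA k (A : set R) : measurable A -> measurable (Y k @^-1` A).
  by move=> mA; rewrite -[X in measurable X]setTI; exact: mY.
have mEK K (A : nat -> set R) : (forall k, measurable (A k)) -> measurable (E K A).
  by move=> mA; apply: fin_bigcap_measurable => // k _; exact: mYA.
have mS m : measurable_fun setT (fun w => \sum_(k < m) Y k w).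
  by apply: measurable_sum.
(* The events [E K A] about later indices make the induction go through. *)
suff : ((\sum_(k < n) v k = 0 /\ forall w, \sum_(k < n) Y k w = 0) \/
    (0 < \sum_(k < n) v k /\ forall K A B, uniq K -> {in K, forall k, n <= k}%N ->
      (forall k, measurable (A k)) -> measurable B ->
      P ((fun w => \sum_(k < n) Y k w) @^-1` B `&` E K A) =
      (normal_prob 0 (Num.sqrt (\sum_(k < n) v k)) B * P (E K A))%E)).
  move=> [[-> _]|[v0 H] _ B mB]; first by rewrite ltxx.
  have := H [::] (fun=> setT) B erefl (fun _ h => ltac:(by [])) (fun=> measurableT) mB.
  have -> : E [::] (fun=> setT) = setT by rewrite /E set_nil bigcap_set0.
  by rewrite setIT probability_setT mule1.
elim: n => [|n IH].
  by left; split; [rewrite big_ord0|move=> w; rewrite big_ord0].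
(* A condition on [Y n] is absorbed into the event on later indices, which lets the induction
   hypothesis apply to it. *)
have EE K (A : nat -> set R) B : n \notin K ->
    Y n @^-1` B `&` E K A = E (n :: K) (fun k => if k == n then B else A k).
  move=> nK; apply/seteqP; split => [w [Bw Ew] k /=|w Ew].
    rewrite inE => /orP[/eqP ->|kK]; first by rewrite eqxx.
    by case: eqP => [kn|_]; [move: nK; rewrite -kn kK|exact: Ew].
  split; first by have := Ew n; rewrite /= mem_head eqxx; exact.
  move=> k /= kK; have := Ew k; rewrite /= inE kK orbT.
  case: eqP => [kn|_]; first by move: nK; rewrite -kn kK.
  by apply.
have PYE K (A : nat -> set R) B : uniq K -> n \notin K -> measurable B ->
    (forall k, measurable (A k)) ->
    P (Y n @^-1` B `&` E K A) = (P (Y n @^-1` B) * P (E K A))%E.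
  move=> uK nK mB mA; rewrite EE// /E !indepY//=; last 2 first.
  - by rewrite nK.
  - by move=> k; case: ifP.
  rewrite big_cons eqxx; congr (_ * _)%E; apply: eq_big_seq => k kK.
  by case: eqP => // kn; move: nK; rewrite -kn kK.
have Kn K : {in K, forall k, n.+1 <= k}%N -> n \notin K.
  by move=> HK; apply/negP => /HK; rewrite ltnn.
have [[vn0 Yn0]|[vn0 lawn]] := lawY n.
  have SE w : \sum_(k < n.+1) Y k w = \sum_(k < n) Y k w.
    by rewrite big_ord_recr/= Yn0 addr0.
  rewrite (_ : (fun w => _) = (fun w => \sum_(k < n) Y k w)); last exact/funext.
  rewrite big_ord_recr/= vn0 addr0.
  case: IH => [[v0 S0]|[v0 H]]; [left|right]; split => //.
    by move=> w; rewrite SE.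
  by move=> K A B uK HK; apply: H => // k /HK /ltnW.
rewrite big_ord_recr/=.
case: IH => [[v0 S0]|[v0 H]]; right.
  rewrite v0 add0r; split => // K A B uK HK mA mB.
  rewrite (_ : _ @^-1` B = Y n @^-1` B) ?PYE ?lawn ?Kn//.
  by apply/seteqP; split => w /=; rewrite big_ord_recr/= S0 add0r.
split; first exact: addr_gt0.
move=> K A B uK HK mA mB.
rewrite (_ : (fun w => _) = (fun w => (\sum_(k < n) Y k w) + Y n w)); last first.
  by apply/funext => w; rewrite big_ord_recr.
have -> : Num.sqrt (\sum_(k < n) v k + v n) = Num.sqrt
    (Num.sqrt (\sum_(k < n) v k) ^+ 2 + Num.sqrt (v n) ^+ 2).
  by rewrite !sqr_sqrtr// ltW.
apply: (normal_sum_indep (fun w => \sum_(k < n) Y k w) (Y n)) => //.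
- by rewrite sqrtr_gt0.
- by rewrite sqrtr_gt0.
- exact: mEK.
- move=> A1 A2 mA1 mA2; rewrite -setIA EE ?Kn// H//; last 3 first.
  + by rewrite /= Kn.
  + by move=> k; rewrite inE => /orP[/eqP ->//|/HK /ltnW].
  + by move=> k; case: ifP.
  by rewrite -EE ?Kn// PYE ?Kn// lawn// muleA.
Qed.

End IndependentNormalSum.

(** * Large deviations for sequences of normal laws *)

Section GaussianLDP.
Context {R : realType}.
Implicit Types (m s a e t x : R) (B F G : set R).

Lemma limn_esup_le_near (u : nat -> \bar R) (l : \bar R) :
  (\forall k \near \oo, (u k <= l)%E) -> (limn_esup u <= l)%E.
Proof.
move=> ul; rewrite /limn_esup limf_esupE.
apply: (@le_trans _ _ (ereal_sup [set u k | k in [set k | (u k <= l)%E]])).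
  by apply: ereal_inf_lbound => /=; exists [set k | (u k <= l)%E].
by apply: ge_ereal_sup => _ [k ukl <-].
Qed.

Lemma limn_einf_ge_near (u : nat -> \bar R) (l : \bar R) :
  (\forall k \near \oo, (l <= u k)%E) -> (l <= limn_einf u)%E.
Proof.
move=> ul; rewrite /limn_einf leeNr; apply: limn_esup_le_near.
by apply: filterS ul => k; rewrite leeN2.
Qed.

Lemma limn_esup_le_cvg_near (u : nat -> \bar R) (v : nat -> R) (l : R) :
  v @ \oo --> l -> (\forall k \near \oo, (u k <= (v k)%:E)%E) ->
  (limn_esup u <= l%:E)%E.
Proof.
move=> vl uv; apply/lee_addgt0Pr => e e0; apply: limn_esup_le_near.
near=> k; apply: (@le_trans _ _ (v k)%:E); first by near: k.
rewrite -EFinD lee_fin -lerBlDl.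
near: k; move/cvgrPdist_le : vl => /(_ _ e0); apply: filterS => k.
by rewrite distrC; apply: le_trans; exact: ler_norm.
Unshelve. all: by end_near. Qed.

Lemma limn_einf_ge_cvg_near (u : nat -> \bar R) (v : nat -> R) (l : R) :
  v @ \oo --> l -> (\forall k \near \oo, ((v k)%:E <= u k)%E) ->
  (l%:E <= limn_einf u)%E.
Proof.
move=> vl uv; rewrite /limn_einf leeNr -EFinN.
apply: (@limn_esup_le_cvg_near _ (fun k => - v k)); first exact: cvgN.
by apply: filterS uv => k; rewrite EFinN leeN2.
Qed.

(* On |x - m| >= a the density is at most exp(-a^2/2s^2) times the sum of the
   densities recentred at m + a and m - a. *)
Lemma normal_prob_tail_le m s a F : 0 < s -> 0 <= a -> measurable F ->
  (forall x, F x -> a <= `|x - m|) ->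
  (normal_prob m s F <= (2 * expR (- (a ^+ 2 / (2 * s ^+ 2))))%:E)%E.
Proof.
move=> s0 a0 mF Fa.
pose c := expR (- (a ^+ 2 / (2 * s ^+ 2))).
have mp m' : measurable_fun setT (fun x => (normal_pdf m' s x)%:E).
  by apply/measurable_EFinP; exact: measurable_normal_pdf.
have pdf_le x : F x -> normal_pdf m s x <=
    c * (normal_pdf (m + a) s x + normal_pdf (m - a) s x).
  move=> /Fa; rewrite !normal_pdfE ?gt_eqF// => ax.
  rewrite /c /normal_fun mulrDr !(mulrCA (expR (- _ ))) -mulrDr.
  apply: ler_wpM2l; first exact: normal_peak_ge0.
  rewrite -!expRD.
  have s2 : 0 < 2 * s ^+ 2 by rewrite mulr_gt0// exprn_gt0.
  (* The premise amounts to b^2 <= b (x - m); it is used with b = a to the right of [m] and b = - a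
     to the left. *)
  have key b : (x - m - b) ^+ 2 + b ^+ 2 <= (x - m) ^+ 2 ->
      - (x - m) ^+ 2 / (s ^+ 2 *+ 2) <=
      - (b ^+ 2 / (2 * s ^+ 2)) + - (x - m - b) ^+ 2 / (s ^+ 2 *+ 2).
    move=> H; rewrite -mulr_natl -[- (b ^+ 2 / _)]mulNr -mulrDl.
    by apply: ler_wpM2r; [rewrite invr_ge0 ltW|lra].
  case: (lerP 0 (x - m)) => xm; [rewrite ger0_norm// in ax|rewrite ltr0_norm// in ax].
  - apply: (@le_trans _ _ (expR (- (a ^+ 2 / (2 * s ^+ 2)) +
      - (x - m - a) ^+ 2 / (s ^+ 2 *+ 2)))).
      by rewrite ler_expR; apply: key; nra.
    by rewrite opprD addrA lerDl expR_ge0.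
  - apply: (@le_trans _ _ (expR (- ((- a) ^+ 2 / (2 * s ^+ 2)) +
      - (x - m - (- a)) ^+ 2 / (s ^+ 2 *+ 2)))).
      by rewrite ler_expR; apply: key; nra.
    rewrite sqrrN (_ : x - (m - a) = x - m - - a); last by ring.
    by rewrite lerDr expR_ge0.
have pdf0 m' x : (0 <= (normal_pdf m' s x)%:E)%E by rewrite lee_fin normal_pdf_ge0.
apply: (@le_trans _ _ (\int[lebesgue_measure]_(x in F)
  (c%:E * ((normal_pdf (m + a) s x)%:E + (normal_pdf (m - a) s x)%:E)))%E).
  apply: ge0_le_integral => //.
  - by apply: measurable_funTS; exact: mp.
  - apply/measurable_funTS/emeasurable_funM => //.
    by apply: emeasurable_funD; exact: mp.
rewrite ge0_integralZl//; first last.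
- by rewrite lee_fin expR_ge0.
- by move=> x _; rewrite adde_ge0.
- by apply/measurable_funTS/emeasurable_funD; exact: mp.
rewrite ge0_integralD//; [|by apply: measurable_funTS; exact: mp..].
rewrite mulrC EFinM lee_wpmul2l ?lee_fin ?expR_ge0//.
rewrite (_ : 2%:E = 1%:E + 1%:E)%E; last by rewrite -EFinD.
by apply: leeD; exact: (probability_le1 (normal_prob _ s) mF).
Qed.

(** On the interval the distance to [m] is at most |t - m| + e, and s <= 1 makes the peak at least
    that of the standard normal; the factor 2e is the length. *)
Lemma normal_prob_itv_ge m s t e : 0 < s -> s <= 1 -> 0 < e ->
  ((2 * e * normal_peak 1 *
    expR (- ((`|t - m| + e) ^+ 2 / (2 * s ^+ 2))))%:E <=
   normal_prob m s [set` `[t - e, t + e]%R])%E.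
Proof.
move=> s0 s1 e0; set c := expR _.
have s2 : 0 < 2 * s ^+ 2 by rewrite mulr_gt0// exprn_gt0.
apply: (@le_trans _ _ (\int[lebesgue_measure]_(x in [set` `[t - e, t + e]%R])
  (cst (normal_peak 1 * c)%:E x))%E); last first.
  apply: ge0_le_integral => //=.
  - by move=> x _; rewrite lee_fin mulr_ge0 ?normal_peak_ge0 ?expR_ge0.
  - by apply/measurable_EFinP/measurable_funTS; exact: measurable_normal_pdf.
  - move=> x; rewrite in_itv/= => /andP[xl xr].
    rewrite lee_fin normal_pdfE ?gt_eqF//.
    apply: ler_pM; rewrite ?normal_peak_ge0 ?expR_ge0//.
    + rewrite /normal_peak lef_pV2 ?posrE ?sqrtr_gt0 ?mulrn_wgt0 ?mulr_gt0 ?exprn_gt0 ?pi_gt0//.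
      rewrite ler_sqrt; last by rewrite mulrn_wge0// mulr_ge0 ?pi_ge0.
      rewrite ler_pMn2r// ler_pM2r ?pi_gt0// expr1n.
      by rewrite expr_le1// ltW.
    + rewrite /c /normal_fun ler_expR -(mulr_natl (s ^+ 2)) -[- (_ / _)]mulNr ler_wpM2r ?invr_ge0 ?(ltW s2)// lerN2.
      rewrite -[(x - m) ^+ 2]real_normK ?num_real// ler_sqr ?nnegrE ?addr_ge0 ?(ltW e0)//.
      rewrite (_ : x - m = (t - m) + (x - t)); last by ring.
      apply: (le_trans (ler_normD _ _)); rewrite lerD2l ler_norml; lra.
rewrite integral_cst//= lebesgue_measure_itv/= lte_fin.
have -> : t - e < t + e by lra.
rewrite -EFinB -EFinM lee_fin.
by rewrite (_ : t + e - (t - e) = 2 * e); [lra|ring].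
Qed.

Lemma cvg_invn : (fun k : nat => (k%:R : R)^-1) @ \oo --> (0 : R).
Proof. by rewrite -cvg_shiftS /=; exact: cvg_harmonic. Qed.

Lemma lne_scaled_le (k : nat) (p : \bar R) (c y : R) : (0 < k)%N -> 0 < c ->
  (0 <= p)%E -> (p <= (c * expR y)%:E)%E ->
  ((k%:R^-1)%:E * lne p <= (k%:R^-1 * (ln c + y))%:E)%E.
Proof.
move=> k0 c0 p0 pc; rewrite EFinM lee_pmul2l//; last first.
  by rewrite lte_fin invr_gt0 ltr0n.
have cy : 0 < c * expR y by rewrite mulr_gt0 ?expR_gt0.
rewrite -[X in (_ + X)%R](expRK y) -lnM ?posrE ?expR_gt0// -lne_EFin//.
by rewrite lee_lne// in_itv/= ?leey ?p0 ?lee_fin ?ltW.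
Qed.

Lemma lne_scaled_ge (k : nat) (p : \bar R) (c y : R) : (0 < k)%N -> 0 < c ->
  ((c * expR y)%:E <= p)%E ->
  ((k%:R^-1 * (ln c + y))%:E <= (k%:R^-1)%:E * lne p)%E.
Proof.
move=> k0 c0 pc; rewrite EFinM lee_pmul2l//; last first.
  by rewrite lte_fin invr_gt0 ltr0n.
have cy : 0 < c * expR y by rewrite mulr_gt0 ?expR_gt0.
have p0 : (0 <= p)%E by apply: le_trans pc; rewrite lee_fin ltW.
rewrite -[X in (_ + X)%R](expRK y) -lnM ?posrE ?expR_gt0// -lne_EFin//.
by rewrite lee_lne// in_itv/= ?leey ?p0 ?lee_fin ?ltW.
Qed.

Lemma gaussian_good_rate (mu v : R) : 0 < v ->
  good_rate (fun t : R => ((t - mu) ^+ 2 / (2 * v))%:E).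
Proof.
move=> v0 a; have q0 : 0 < 2 * v by rewrite mulr_gt0.
have [a0|a0] := ltP a 0.
  rewrite (_ : [set t | _] = set0); first exact: compact0.
  apply/seteqP; split => t //=; rewrite lee_fin => ta.
  have : 0 <= (t - mu) ^+ 2 / (2 * v) by rewrite divr_ge0 ?sqr_ge0// ltW.
  by move=> /le_trans /(_ ta); rewrite leNgt a0.
pose c := Num.sqrt (a * (2 * v)).
rewrite (_ : [set t | _] = [set` `[mu - c, mu + c]%R]); first exact: segment_compact.
apply/seteqP; split => t /=; rewrite lee_fin ler_pdivrMr// in_itv/=.
  rewrite -(ler_sqrt _ (mulr_ge0 a0 (ltW q0))) sqrtr_sqr -/c ler_norml; lra.
move=> H; rewrite -(ler_sqrt _ (mulr_ge0 a0 (ltW q0))) sqrtr_sqr -/c ler_norml; lra.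
Qed.

(** Closed sets are bounded through their distance to the mean, open sets through a small interval
    around each of their points. Prefactors disappear in the scaled logarithm. *)
Lemma gaussian_LDP (theta : nat -> set R -> \bar R) (m s : nat -> R) (mu v : R) :
  0 < v -> m @ \oo --> mu -> (fun k => k%:R * s k ^+ 2) @ \oo --> v ->
  (\forall k \near \oo, 0 < s k) ->
  (\forall k \near \oo, forall B, measurable B ->
    theta k B = normal_prob (m k) (s k) B) ->
  LDP theta (fun t : R => ((t - mu) ^+ 2 / (2 * v))%:E).
Proof.
move=> v0 mmu ksv s_gt0 thetaE; set I := fun t : R => _.
have v20 : 2 * v != 0 by rewrite gt_eqF// mulr_gt0.
have I_ge0 t : (0 <= I t)%E.
  by rewrite lee_fin divr_ge0 ?sqr_ge0 ?mulr_ge0 ?ltW.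
have k_gt0 : \forall k \near \oo, (0 < k)%N by exact: nbhs_infty_gt.
(* The limit of the scaled exponent that serves both bounds: [a] is the distance used and [b] the
   logarithm of the prefactor. *)
have cvg_rate (a : nat -> R) (A b : R) : a @ \oo --> A ->
    (fun k => k%:R^-1 * (b + - (a k ^+ 2 / (2 * s k ^+ 2)))) @ \oo -->
    - (A ^+ 2 / (2 * v)).
  move=> aA.
  have : (fun k => k%:R^-1 * b - a k ^+ 2 / (2 * (k%:R * s k ^+ 2))) @ \oo -->
      0 * b - A ^+ 2 / (2 * v).
    apply: cvgB; first by apply: cvgMl; exact: cvg_invn.
    apply: cvgM; first exact: cvgM.
    by apply: cvgV => //; apply: cvgMr.
  rewrite mul0r add0r; apply: cvg_trans; apply: near_eq_cvg.
  near=> k; rewrite mulrDr mulrN; congr (_ - _).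
  have k0 : k%:R != 0 :> R by rewrite pnatr_eq0 -lt0n; near: k.
  have sk0 : s k != 0 by rewrite gt_eqF//; near: k.
  by field; rewrite k0 sk0.
split => [F cF|G oG].
- have mF := closed_measurable cF.
  (* For the empty set both sides are minus infinity. *)
  have [->|/set0P[x0 Fx0]] := eqVneq F set0.
    rewrite image_set0 ereal_inf0 /=; apply: limn_esup_le_near.
    near=> k; rewrite (near thetaE k)// measure0 le0_lneNy//.
    by rewrite gt0_muleNy// lte_fin invr_gt0 ltr0n; near: k.
  have infE : ereal_inf (I @` F) = (fine (ereal_inf (I @` F)))%:E.
    rewrite fineK// fin_real//; apply/andP; split.
      by apply: lt_le_trans (ltNyr 0) _; apply: le_ereal_inf_tmp => _ [x _ <-].
    apply: le_lt_trans (ltry ((x0 - mu) ^+ 2 / (2 * v))).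
    by apply: ereal_inf_lbound; exists x0.
  set i := fine _ in infE; rewrite infE.
  have i_ge0 : 0 <= i by rewrite -lee_fin -infE; apply: le_ereal_inf_tmp => _ [x _ <-].
  (* A lower bound for the distance from [mu] to [F], read off from the infimum of the rate. *)
  pose c := Num.sqrt (i * (2 * v)).
  have c2 : c ^+ 2 = i * (2 * v) by rewrite sqr_sqrtr// !mulr_ge0// ltW.
  have Fc x : F x -> c <= `|x - mu|.
    move=> Fx; rewrite -sqrtr_sqr ler_sqrt ?sqr_ge0//.
    rewrite -ler_pdivlMr ?mulr_gt0// -lee_fin -infE.
    by apply: ereal_inf_lbound; exists x.
  (* The bound on the distance, moved from [mu] to the actual mean [m k]; the tail estimate asks for
     a nonnegative number, whence the truncation. *)
  pose a k := Num.max 0 (c - `|m k - mu|).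
  have ac : a @ \oo --> c.
    have c_ge0 : 0 <= c by exact: sqrtr_ge0.
    apply/cvgrPdist_le => e e0; move/cvgrPdist_le : mmu => /(_ _ e0).
    apply: filterS => k; rewrite distrC /a maxEle => mk.
    by case: ifPn; rewrite -?ltNge ler_norml => H; apply/andP; split;
      have := normr_ge0 (m k - mu); lra.
  have := cvg_rate a c (ln 2) ac.
  rewrite c2 mulfK// -EFinN => /limn_esup_le_cvg_near; apply.
  near=> k.
  have sk : 0 < s k by near: k.
  rewrite (near thetaE k)//; apply: lne_scaled_le => //; first by near: k.
  apply: normal_prob_tail_le => //; first by rewrite le_max lexx.
  move=> x /Fc cx; rewrite ge_max normr_ge0/= lerBlDr.
  apply: (le_trans cx); rewrite (_ : x - mu = (x - m k) + (m k - mu)); last by ring.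
  exact: ler_normD.
- have mG := open_measurable oG.
  rewrite leeNl; apply: le_ereal_inf_tmp => _ [t Gt <-]; rewrite leeNl.
  (* The variance is 1/k times a convergent sequence, so it tends to 0. *)
  have s_le1 : \forall k \near \oo, s k <= 1.
    have : (fun k => k%:R^-1 * (k%:R * s k ^+ 2)) @ \oo --> 0 * v.
      by apply: cvgM => //; exact: cvg_invn.
    rewrite mul0r => /cvgrPdist_le /(_ 1 ltr01) H.
    near=> k; have sk : 0 < s k by near: k.
    have k0 : k%:R != 0 :> R by rewrite pnatr_eq0 -lt0n; near: k.
    have : `|0 - k%:R^-1 * (k%:R * s k ^+ 2)| <= 1 by near: k.
    by rewrite sub0r normrN mulKf// ger0_norm ?sqr_ge0// expr_le1// ltW.
  have [d /= d0 dG] : exists2 d : R, 0 < d & forall x, `|t - x| < d -> G x.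
    have /nbhs_ballP[d /= d0 dG] := open_nbhs_nbhs (conj oG Gt).
    by exists d.
  have lower e : 0 < e -> e < d ->
      ((- ((`|t - mu| + e) ^+ 2 / (2 * v)))%:E <=
       limn_einf (fun k => (k%:R^-1)%:E * lne (theta k G)))%E.
    move=> e0 ed.
    have at_ : (fun k => `|t - m k| + e) @ \oo --> `|t - mu| + e.
      by apply: cvgD; [apply: cvg_norm; apply: cvgB => //|]; exact: cvg_cst.
    have := cvg_rate _ _ (ln (2 * e * normal_peak 1)) at_.
    move=> /limn_einf_ge_cvg_near; apply.
    near=> k; have sk : 0 < s k by near: k.
    apply: lne_scaled_ge; first by near: k.
      by rewrite !mulr_gt0// normal_peak_gt0.
    rewrite (near thetaE k)//.
    apply: le_trans (normal_prob_itv_ge _ _ _ _ sk _ e0) _; first by near: k.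
    apply: le_measure; rewrite ?inE//= => x /=; rewrite in_itv/= => H.
    by apply: dG; rewrite ltr_norml; lra.
  apply/lee_subgt0Pr => e e0.
  pose A := `|t - mu|; have A0 : 0 <= A by exact: normr_ge0.
  (* With A = |t - mu| and e1 <= 1, (A + e1)^2 - A^2 <= (2A + 1) e1 <= 2 v e; the bound d/2 keeps
     the interval inside [G]. *)
  pose e1 := Num.min (d / 2) (Num.min 1 (2 * v * e / (2 * A + 1))).
  have e1_gt0 : 0 < e1.
    by rewrite !lt_min ltr01 !divr_gt0 ?mulr_gt0//= ltr_wpDl// mulr_ge0.
  have e1d : e1 < d by rewrite gt_min; apply/orP; left; lra.
  apply: le_trans (lower _ e1_gt0 e1d).
  rewrite -EFinN -EFinB lee_fin -/A -opprD lerN2.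
  rewrite ler_pdivrMr ?mulr_gt0// mulrDl divfK// -[(t - mu) ^+ 2]real_normK ?num_real// -/A.
  have e11 : e1 <= 1 by rewrite !ge_min lexx orbT.
  have : e1 <= 2 * v * e / (2 * A + 1) by rewrite !ge_min lexx !orbT.
  rewrite ler_pdivlMr; last by rewrite ltr_wpDl// mulr_ge0.
  nra.
Unshelve. all: by end_near. Qed.

End GaussianLDP.

(** * The consensus state as a linear function of the noise *)

Section RunningConsensus.
Context {R : realType} {d : measure_display} {T : measurableType d} {N : nat}.

(** Multiplying the recursion by k + 1 removes its fractions. Index [n] stands for time n + 1, so
    the observation of time j + 1 has passed through the n - j factors W(n) ... W(j+1). *)
Lemma xs_closed_form (m0 m1 : 'cV[R]_N) (S : 'M[R]_N)
    (zeta : nat -> 'I_N -> T -> R) (W : nat -> 'M[R]_N) (l : bool) n w :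
  xs m0 m1 S zeta W l n w = (n.+1%:R^-1 * N%:R) *:
    \sum_(j < n.+1) trans_mx W j.+1 (n - j) *m Defs.eta m0 m1 S zeta l j.+1 w.
Proof.
elim: n => [|n IH].
  by rewrite big_ord_recr big_ord0 /= add0r mul1mx invr1 mul1r.
have IH' := IH; rewrite [LHS]/= IH' -scalemxAr scalerA mulmx_sumr.
rewrite [in RHS]big_ord_recr/= subnn mul1mx scalerDr; congr (_ + _).
rewrite mulrACA divff ?pnatr_eq0// mul1r; congr (_ *: _).
apply: eq_bigr => j _; have jn : (j <= n)%N by rewrite -ltnS.
by rewrite subSn// mulmxA /= addSn subnKC.
Qed.

Lemma gaussian_linear_sum (P : probability T R) (zeta : nat -> 'I_N -> T -> R)
    (S : 'M[R]_N) (u : nat -> 'cV[R]_N) (n : nat) :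
  (forall u : 'cV[R]_N, u != 0 -> 0 < (u^T *m S *m u) 0 0) ->
  (forall k i, (0 < k)%N -> measurable_fun setT (zeta k i)) ->
  indep_vectors P zeta -> gaussian_vectors P zeta S ->
  0 < \sum_(j < n) ((u j)^T *m S *m u j) 0 0 ->
  forall B, measurable B ->
    P ((fun w => \sum_(j < n) \sum_r u j r 0 * zeta j.+1 r w) @^-1` B) =
    normal_prob 0 (Num.sqrt (\sum_(j < n) ((u j)^T *m S *m u j) 0 0)) B.
Proof.
move=> posS mz ind gauss v0 B mB.
apply: (normal_sum P (fun j w => \sum_r u j r 0 * zeta j.+1 r w)
  (fun j => ((u j)^T *m S *m u j) 0 0)) => //.
- move=> k; apply: measurable_sum => r; apply: measurable_funM => //.
  exact: mz.
- move=> K A uK mA.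
  (* The noise is indexed from time 1 and the summands from 0; the predecessor realigns them. *)
  pose A' k := (fun w => \sum_r u k.-1 r 0 * zeta k r w) @^-1` A k.-1.
  have := ind (map succn K) A'.
  rewrite big_map map_inj_uniq; last exact: succn_inj.
  move=> /(_ uK); rewrite all_map.
  have -> : all (preim succn (fun k => (0 < k)%N)) K by apply/allP.
  move=> /(_ isT) <-.
  + congr (P _); apply/seteqP; split => w Hw k /= kK.
      by move/mapP : kK => [k' k'K ->]; exact: (Hw k').
    by apply: (Hw k.+1) => /=; rewrite mem_map//; exact: succn_inj.
  + move=> _ /mapP[k kK ->]; rewrite /A' /sigma_vec /=.
    (* Each summand is measurable for the sigma-algebra generated by one noise vector, so its events
       qualify for the independence hypothesis. *)
    pose G := \bigcup_(i in [set: 'I_N])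
      preimage_set_system setT (zeta k.+1 i) measurable.
    have mzG r : measurable_fun setT (zeta k.+1 r : g_sigma_algebraType G -> R).
      move=> _ C mC; apply: sub_sigma_algebra; exists r => //.
      by exists C.
    have : measurable_fun setT
        (fun w : g_sigma_algebraType G => \sum_r u k r 0 * zeta k.+1 r w).
      by apply: measurable_sum => r; apply: measurable_funM => //; exact: mzG.
    by move=> /(_ measurableT _ (mA k)); rewrite setTI.
- move=> k; have [->|uk] := eqVneq (u k) 0.
    left; split; first by rewrite mulmx0 mxE.
    by move=> w; rewrite big1// => r _; rewrite mxE mul0r.
  by right; split; [exact: posS|move=> C mC; exact: gauss].
Qed.

End RunningConsensus.

(** * Limits of the mean and variance at a node, and the large deviations principle *)

Lemma cvg_sum_fin {R : realType} {U : Type} {F : set_system U} {FF : Filter F}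
    (n : nat) (f : 'I_n -> U -> R) (a : 'I_n -> R) :
  (forall r, f r @ F --> a r) -> (fun x => \sum_r f r x) @ F --> \sum_r a r.
Proof.
move=> fa; apply: cvg_big => //; exact: add_continuous.
Qed.

Lemma mx_formE {R : comPzRingType} (n : nat) (S : 'M[R]_n) (u : 'cV[R]_n) :
  (u^T *m S *m u) 0 0 = \sum_r \sum_t u t 0 * S t r * u r 0.
Proof.
rewrite mxE; apply: eq_bigr => r _; rewrite mxE mulr_suml.
by apply: eq_bigr => t _; rewrite mxE.
Qed.

(** A nonzero row vector annihilated by [S] would make the quadratic form vanish. *)
Lemma posdef_unitmx {R : realType} (n : nat) (S : 'M[R]_n) :
  (forall u : 'cV[R]_n, u != 0 -> 0 < (u^T *m S *m u) 0 0) -> S \in unitmx.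
Proof.
move=> posS; rewrite unitmxE unitfE; apply/negP => /det0P[x x0 xS].
have := posS x^T; rewrite trmxK xS mul0mx mxE ltxx => /(_ _)/negP; apply => //.
by apply: contra x0 => /eqP/(congr1 trmx); rewrite trmxK trmx0 => ->.
Qed.

Theorem theorem9 (R : realType) (d : measure_display) (T : measurableType d)
  (P : probability T R) (N : nat) (m0 m1 : 'cV[R]_N) (S : 'M[R]_N)
  (zeta : nat -> 'I_N -> T -> R) (W : nat -> 'M[R]_N) :
  m0 != m1 ->
  S^T = S ->
  (forall u : 'cV[R]_N, u != 0 -> 0 < (u^T *m S *m u) 0 0) ->
  (forall k i, (0 < k)%N -> measurable_fun setT (zeta k i)) ->
  indep_vectors P zeta ->
  gaussian_vectors P zeta S ->
  W_sym_stoch W -> W_min_cond W -> B_connected W ->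
  let sigmaL2 := ((m1 - m0)^T *m invmx S *m (m1 - m0)) 0 0 in
  forall (i : 'I_N) (l : bool),
    let mL := (-1) ^+ (nat_of_bool l).+1 / 2 * sigmaL2 in
    let I := fun t : R => ((t - mL) ^+ 2 / (2 * sigmaL2))%:E in
    LDP (law_x P m0 m1 S zeta W i l) I /\ good_rate I.
Proof.
move=> m01 Ssym posS mz ind gauss HW Hw HB sigmaL2 i l mL I.
have Su := posdef_unitmx _ _ posS.
pose dm := m1 - m0; pose v := invmx S *m dm.
have dmv : dm = S *m v by rewrite mulKVmx.
have vTE : v^T = dm^T *m invmx S by rewrite trmx_mul trmx_inv Ssym.
have sigmaE : sigmaL2 = (v^T *m S *m v) 0 0 by rewrite vTE mulmxKV// mulmxA.
have v0 : v != 0.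
  apply: contra m01 => /eqP v0; move: dmv; rewrite v0 mulmx0 => /eqP.
  by rewrite subr_eq0 eq_sym.
have sigma0 : 0 < sigmaL2 by rewrite sigmaE posS.
split; last exact: gaussian_good_rate.
have N0 : N%:R != 0 :> R by rewrite pnatr_eq0; case: (N) i => [[]|].
pose Phi (p : nat * nat) r := trans_mx W p.1.+1 p.2 i r.
have Phi1 p r : `|Phi p r| <= 1.
  have [ge0 row1 _] := trans_mx_doubly_stochastic W p.1.+1 p.2 HW (ltn0Sn _).
  rewrite ger0_norm; last exact: ge0.
  by rewrite -[leRHS](row1 i) (bigD1 r)//= lerDl sumr_ge0.
(* For p = (j, n), up to the factor 1/k, [c p] holds the coefficients in x_i(k) of the noise of time
   j + 1 after [n] mixing steps; [h p] is the resulting mean and [g p] the variance. *)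
pose c p : 'cV[R]_N := \col_r (N%:R * v r 0 * Phi p r).
pose offset r := (if l then m1 else m0) r 0 - (m1 r 0 + m0 r 0) / 2.
pose g p := ((c p)^T *m S *m c p) 0 0.
pose h p := \sum_r c p r 0 * offset r.
have c_bnd p r : `|c p r 0| <= `|N%:R * v r 0|.
  by rewrite mxE normrM ler_piMr.
have c_cvg r : (fun p => c p r 0) @ filter_prod (globally setT) \oo --> v r 0.
  have -> : (fun p => c p r 0) = (fun p => N%:R * v r 0 * Phi p r).
    by apply/funext => p; rewrite mxE.
  have : (fun p => N%:R * v r 0 * Phi p r) @ filter_prod (globally setT) \oo -->
      N%:R * v r 0 * N%:R^-1 by apply: cvgMr; exact: trans_mx_cvg.
  by rewrite mulrAC divff// mul1r.
have g_cvg : g @ filter_prod (globally setT) \oo --> sigmaL2.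
  rewrite sigmaE mx_formE; have -> : g = (fun p => \sum_r \sum_t c p t 0 * S t r * c p r 0).
    by apply/funext => p; rewrite /g mx_formE.
  apply: cvg_sum_fin => r; apply: cvg_sum_fin => t.
  by apply: cvgM => //; apply: cvgMl.
(* Each [offset] is plus or minus half the difference of the means, so pairing it with [v] gives
   half of [sigmaL2] up to sign. *)
have h_cvg : h @ filter_prod (globally setT) \oo --> mL.
  rewrite (_ : mL = \sum_r v r 0 * offset r); last first.
    have -> : mL = (-1) ^+ l.+1 / 2 * \sum_r v r 0 * dm r 0.
      by congr (_ * _); rewrite sigmaE -mulmxA -dmv mxE; apply: eq_bigr => r _; rewrite mxE.
    rewrite mulr_sumr; apply: eq_bigr => r _; rewrite /offset !mxE.
    by case: (l); rewrite ?expr1 ?expr2; field.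
  by apply: cvg_sum_fin => r; apply: cvgMl.
pose m k := k%:R^-1 * \sum_(j < k) h (j : nat, (k.-1 - j)%N).
pose u k j := k%:R^-1 *: c (j, (k.-1 - j)%N).
pose var k := \sum_(j < k) ((u k j)^T *m S *m u k j) 0 0.
have etaE k w r : Defs.eta m0 m1 S zeta l k w r 0 = v r 0 * (offset r + zeta k r w).
  by rewrite mxE; congr (_ * _); rewrite !mxE /offset; case: (l); ring.
have xE k w : (0 < k)%N -> xrc m0 m1 S zeta W l k w i 0 =
    m k + \sum_(j < k) \sum_r u k j r 0 * zeta j.+1 r w.
  case: k => // k _; rewrite /xrc /= xs_closed_form mxE summxE -mulrA.
  have -> : \sum_(j < k.+1) \sum_r u k.+1 j r 0 * zeta j.+1 r w =
      \sum_(j < k.+1) k.+1%:R^-1 *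
        \sum_r c (j : nat, (k - j)%N) r 0 * zeta j.+1 r w.
    apply: eq_bigr => j _; rewrite mulr_sumr; apply: eq_bigr => r _.
    by rewrite /u mxE mulrA.
  rewrite -mulr_sumr /m -mulrDr -big_split/= [in LHS]mulr_sumr; congr (_ * _).
  apply: eq_bigr => j _; rewrite mxE mulr_sumr /h -big_split/=.
  apply: eq_bigr => r _; rewrite etaE [c _ _ _]mxE /Phi /=.
  by ring.
(* The coefficients enter squared, giving 1/k^2, of which [k] cancels one factor; for k = 0 both
   sides are 0. *)
have varE k : k%:R * var k = k%:R^-1 * \sum_(j < k) g (j : nat, (k.-1 - j)%N).
  rewrite /var !mulr_sumr; apply: eq_bigr => j _.
  rewrite /u [(_ *: _)^T]linearZ/= -!scalemxAl -scalemxAr scalerA mxE -/(g _) mulrA.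
  congr (_ * _); have [->|k0] := eqVneq (k%:R : R) 0; first by rewrite mul0r invr0.
  by rewrite mulrA divff// mul1r.
have var_ge0 k : 0 <= var k.
  apply: sumr_ge0 => j _; have [->|u0] := eqVneq (u k j) 0; last exact/ltW/posS.
  by rewrite mulmx0 mxE.
have ks_cvg : (fun k => k%:R * Num.sqrt (var k) ^+ 2) @ \oo --> sigmaL2.
  under eq_fun do rewrite sqr_sqrtr// varE.
  apply: (cesaro_diag g _ (\sum_r \sum_t `|N%:R * v t 0| * `|S t r| * `|N%:R * v r 0|)) => // p.
  rewrite /g mx_formE; apply: (le_trans (ler_norm_sum _ _ _)); apply: ler_sum => r _.
  apply: (le_trans (ler_norm_sum _ _ _)); apply: ler_sum => t _.
  rewrite (normrM (_ * _)) (normrM (c p t 0)).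
  by apply: ler_pM; rewrite ?mulr_ge0// ler_wpM2r.
have m_cvg : m @ \oo --> mL.
  apply: (cesaro_diag h _ (\sum_r `|N%:R * v r 0| * `|offset r|)) => // p.
  apply: (le_trans (ler_norm_sum _ _ _)); apply: ler_sum => r _.
  by rewrite normrM; apply: ler_pM.
(* A zero variance would put k Var x_i(k) at distance [sigmaL2] from its positive limit. *)
have var_gt0 : \forall k \near \oo, 0 < var k.
  near=> k; rewrite lt_def var_ge0 andbT; apply/negP => /eqP vark.
  have : `|sigmaL2 - k%:R * Num.sqrt (var k) ^+ 2| < sigmaL2.
    by near: k; move/cvgrPdist_lt : ks_cvg; exact.
  by rewrite vark sqrtr0 expr0n/= mulr0 subr0 gtr0_norm// ltxx.
apply: (gaussian_LDP _ m (fun k => Num.sqrt (var k))) => //.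
  by apply: filterS var_gt0 => k; rewrite sqrtr_gt0.
near=> k => B mB.
have vark : 0 < var k by near: k.
have k0 : (0 < k)%N by near: k; exact: nbhs_infty_gt.
(* The mean is moved into the event, which leaves the centered linear sum of the noise. *)
rewrite -normal_prob_translate//; last by rewrite gt_eqF// sqrtr_gt0.
rewrite -(gaussian_linear_sum P zeta S (u k) k)//; last first.
  by rewrite -[X in measurable X]setTI; exact: measurable_translate.
by rewrite /law_x; congr (P _); apply/seteqP; split => w /=; rewrite xE.
Unshelve. all: by end_near. Qed.
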